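(* Let $f:M\to\mathbb{R}^n$ be a generalised $H$-surface with parallel unit normal section $N$ such that $(\mathbf{H},N)=H$ is constant, where $\mathbf{H}$ is the mean curvature vector of $f$, with polarisation chosen so that $f^c=Hf+N$. Fix a base-point $o\in M$ and choose an initial condition $v\in\mathbb{R}^n$ and a parameter $r\in\mathbb{R}\setminus\{0\}$ so that $g(o)=v-f(o)$ satisfies $$rH\,g(o)^2-r\{g(o),N(o)\}=1,$$ where $\{a,b\}=ab+ba$ in $C\ell_n$. Then the Darboux transform $\mathcal{D}^v_rf$ is also a generalised $H$-surface with the same $H$: it admits a parallel unit normal section $\hat N$ with $(\hat{\mathbf{H}},\hat N)=H$, where $\hat{\mathbf{H}}$ is its mean curvature vector.
   Context: $C\ell_n$ is the real Clifford algebra of Euclidean $\mathbb{R}^n$, with $vw+wv=-2(v,w)1$; nonzero vectors are invertible. For $C\ell_n$-valued 1-forms, $(\alpha\wedge\beta)(X,Y)=\alpha(X)\beta(Y)-\alpha(Y)\beta(X)$. The mean curvature vector of an immersed surface is $\mathbf{H}=\tfrac12\operatorname{trace}\nabla df$. An isoperimetric section is a unit normal vector field $N$ with $(\mathbf{H},N)$ constant; a generalised $H$-surface is an immersed surface admitting an isoperimetric section that is parallel for the normal connection. For such $f,N$ with $(\mathbf{H},N)=H$, the map $Hf+N$, assumed non-constant, is dual to $f$: $df\wedge(H\,df+dN)=0$. One takes $f^c=Hf+N$ as Christoffel transform of $f$, which fixes the polarisation $Q=(df,df^c)^{2,0}$ on $M$. For $r\in\mathbb{R}\setminus\{0\}$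 and $v\in\mathbb{R}^n$, $\mathcal{D}^v_rf=f+g$ where $g:M\to\mathbb{R}^n$ solves $dg=r\,g\,df^c\,g-df$ (products in $C\ell_n$) with $g(o)=v-f(o)$. Statements are local: the solution $g$ is taken on a connected neighbourhood of $o$ on which it exists and is nonvanishing, and geometric statements about $f+g$ refer to where it is immersed (away from the zeros of $Q$). *)

(* Defs.v *)
From HB Require Import structures.
From mathcomp Require Import all_boot all_order all_algebra.
From mathcomp Require Import all_classical all_reals all_analysis.
From mathcomp Require Import ring lra.

Set Implicit Arguments.
Unset Strict Implicit.
Unset Printing Implicit Defensive.

Import Order.TTheory GRing.Theory Num.Theory.
Import numFieldNormedType.Exports.

Local Open Scope ring_scope.

Definition dot (R : realType) (n : nat) (u v : 'rV[R]_n) : R :=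
  \sum_i u 0 i * v 0 i.

(** * The Clifford algebra of Euclidean R^n

    An element is its family of coordinates on the basis
    e_A = e_(i1) * ... * e_(ik), for A = {i1 < ... < ik} a subset of 'I_n.
    Since e_i * e_j = - e_j * e_i for i != j and e_i * e_i = -1, one has
    e_A * e_B = cl_sign A B * e_(A symdiff B). *)

Definition symdiff (n : nat) (A B : {set 'I_n}) : {set 'I_n} :=
  [set i | (i \in A) (+) (i \in B)].

(** One factor -1 for each transposition needed to sort the concatenation of A
    and B, and one for each square e_i * e_i that then appears. *)
Definition cl_sign (R : realType) (n : nat) (A B : {set 'I_n}) : R :=
  \prod_(i in A) \prod_(j in B | (j <= i)%N) -1.

Definition clifford (R : realType) (n : nat) := {ffun {set 'I_n} -> R^o}.

HB.instance Definition _ (R : realType) (n : nat) :=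
  GRing.Lmodule.on (clifford R n).

Section CliffordRing.
Variables (R : realType) (n : nat).
Implicit Types (A B C : {set 'I_n}) (a b c : clifford R n).

Definition cl_one : clifford R n := [ffun A => (A == finset.set0)%:R].

(** The sum over A symdiff B = C, parametrised by A. *)
Definition cl_mul a b : clifford R n :=
  [ffun C => \sum_(A : {set 'I_n})
     cl_sign R A (symdiff A C) * (a A * b (symdiff A C))].

Let symdK A : involutive (symdiff A).
Proof. by move=> B; apply/setP=> i; rewrite !inE addbA addbb. Qed.

Let symdA : associative (@symdiff n).
Proof. by move=> A B C; apply/setP=> i; rewrite !inE addbA. Qed.

Let symd0 A : symdiff A finset.set0 = A.
Proof. by apply/setP=> i; rewrite !inE addbF. Qed.

Let symd0l A : symdiff finset.set0 A = A.
Proof. by apply/setP=> i; rewrite !inE. Qed.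

Let symdC A B : symdiff A B = symdiff B A.
Proof. by apply/setP=> i; rewrite !inE addbC. Qed.

Let cl_signE A B : cl_sign R A B =
  \prod_(i < n) \prod_(j : 'I_n | (j <= i)%N) (-1) ^+ ((i \in A) && (j \in B)).
Proof.
rewrite /cl_sign big_mkcond; apply: eq_bigr => i _.
case: (i \in A) => /=; last by rewrite big1.
rewrite [RHS]big_mkcond /= [LHS]big_mkcond /=.
by apply: eq_bigr => j _; case: (j \in B); case: (j <= i)%N.
Qed.

Let cl_signDl A B C :
  cl_sign R (symdiff A B) C = cl_sign R A C * cl_sign R B C.
Proof.
rewrite !cl_signE -big_split; apply: eq_bigr => i _ /=.
rewrite -big_split; apply: eq_bigr => j _ /=.
by rewrite inE andb_addl signr_addb.
Qed.

Let cl_signDr A B C :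
  cl_sign R A (symdiff B C) = cl_sign R A B * cl_sign R A C.
Proof.
rewrite !cl_signE -big_split; apply: eq_bigr => i _ /=.
rewrite -big_split; apply: eq_bigr => j _ /=.
by rewrite inE andb_addr signr_addb.
Qed.

Let cl_sign0l A : cl_sign R finset.set0 A = 1.
Proof. by rewrite /cl_sign big_set0. Qed.

Let cl_sign0r A : cl_sign R A finset.set0 = 1.
Proof. by rewrite /cl_sign big1 // => i _; rewrite big1 // => j; rewrite inE. Qed.

Let cl_mulA : associative cl_mul.
Proof.
move=> a b c; apply/ffunP=> D; rewrite !ffunE.
under eq_bigr => A _ do rewrite ffunE !mulr_sumr.
under [RHS]eq_bigr => B _ do rewrite ffunE mulr_suml mulr_sumr.
rewrite [RHS]exchange_big /=; apply: eq_bigr => A _.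
rewrite [RHS](reindex_inj (inv_inj (symdK A))) /=; apply: eq_bigr => B _.
rewrite symdK (symdC A B) -symdA (symdC B (symdiff A D)) cl_signDl.
have -> : symdiff (symdiff A D) B = symdiff B (symdiff A D) by rewrite symdC.
rewrite -[in LHS](symdK B (symdiff A D)) [in X in X * _ = _]cl_signDr.
rewrite !symdK; ring.
Qed.

Let cl_mul1l : left_id cl_one cl_mul.
Proof.
move=> a; apply/ffunP=> D; rewrite ffunE (bigD1 finset.set0) //= big1 => [|A /negPf nA].
  by rewrite ffunE eqxx symd0l cl_sign0l !mul1r addr0.
by rewrite ffunE nA mul0r mulr0.
Qed.

Let cl_mul1r : right_id cl_one cl_mul.
Proof.
move=> a; apply/ffunP=> D; rewrite ffunE (bigD1 D) //= big1 => [|A nA].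
  have -> : symdiff D D = finset.set0 by apply/setP=> i; rewrite !inE addbb.
  by rewrite ffunE eqxx cl_sign0r mul1r mulr1 addr0.
rewrite ffunE; case: eqP => [E|_]; last by rewrite !mulr0.
by case/eqP: nA; rewrite -(symd0 A) -E symdK.
Qed.

Let cl_mulDl : left_distributive cl_mul +%R.
Proof.
move=> a b c; apply/ffunP=> D; rewrite !ffunE -big_split /=.
by apply: eq_bigr => A _; rewrite !ffunE mulrDl mulrDr.
Qed.

Let cl_mulDr : right_distributive cl_mul +%R.
Proof.
move=> a b c; apply/ffunP=> D; rewrite !ffunE -big_split /=.
by apply: eq_bigr => A _; rewrite !ffunE !mulrDr.
Qed.

Let cl_one_neq0 : cl_one != 0.
Proof.
by apply/eqP=> /ffunP/(_ finset.set0); rewrite !ffunE eqxx; apply/eqP/oner_neq0.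
Qed.

HB.instance Definition _ := GRing.Zmodule_isNzRing.Build (clifford R n)
  cl_mulA cl_mul1l cl_mul1r cl_mulDl cl_mulDr cl_one_neq0.

Let cl_scaleAl (k : R) a b : k *: (a * b) = (k *: a) * b.
Proof.
apply/ffunP=> D; rewrite !ffunE scaler_sumr; apply: eq_bigr => A _.
rewrite ffunE /GRing.scale /=; ring.
Qed.

HB.instance Definition _ :=
  GRing.Lmodule_isLalgebra.Build R (clifford R n) cl_scaleAl.

Let cl_scaleAr (k : R) a b : k *: (a * b) = a * (k *: b).
Proof.
apply/ffunP=> D; rewrite !ffunE scaler_sumr; apply: eq_bigr => A _.
rewrite ffunE /GRing.scale /=; ring.
Qed.

HB.instance Definition _ :=
  GRing.Lalgebra_isAlgebra.Build R (clifford R n) cl_scaleAr.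

Definition cl_basis A : clifford R n := [ffun B => (B == A)%:R].

Lemma cl_basisM A B :
  cl_basis A * cl_basis B = cl_sign R A B *: cl_basis (symdiff A B).
Proof.
apply/ffunP=> D; rewrite !ffunE (bigD1 A) //= big1 => [|C /negPf nC].
  rewrite !ffunE eqxx mul1r addr0 -(inj_eq (inv_inj (symdK A)) D) symdK.
  by case: eqP => [->|_]; rewrite // scaler0 mulr0.
by rewrite !ffunE nC mul0r mulr0.
Qed.

(** The inclusion of R^n in its Clifford algebra. *)
Definition cl_vec (v : 'rV[R]_n) : clifford R n :=
  \sum_i v 0 i *: cl_basis [set i].

Lemma cl_vec_clifford (v w : 'rV[R]_n) :
  cl_vec v * cl_vec w + cl_vec w * cl_vec v = (- 2 * dot v w)%:A.
Proof.
have Hs (i j : 'I_n) : cl_sign R [set i] [set j] = if (j <= i)%N then -1 else 1.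
  rewrite /cl_sign big_set1 big_mkcondr big_set1 //.
have HM (i j : 'I_n) : cl_basis [set i] * cl_basis [set j]
    + cl_basis [set j] * cl_basis [set i] = (- 2 * (i == j)%:R)%:A.
  rewrite !cl_basisM (symdC [set j]) !Hs -scalerDl.
  case: (eqVneq i j) => [<-|nij]; last first.
    rewrite mulr0 scale0r; case: (ltngtP i j) => [||/val_inj E].
    - by rewrite subrr scale0r.
    - by rewrite addNr scale0r.
    - by rewrite E eqxx in nij.
  rewrite leqnn mulr1 -opprD; congr (_ *: _); last first.
  by apply/ffunP=> B; rewrite !ffunE; congr (B == _)%:R; apply/setP=> k;
     rewrite !inE addbb.
rewrite /cl_vec !big_distrlr /= exchange_big /= -big_split /=.
transitivity (\sum_i \sum_j (v 0 j * w 0 i) *: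
    (cl_basis [set j] * cl_basis [set i] + cl_basis [set i] * cl_basis [set j])).
  apply: eq_bigr => i _; rewrite -big_split; apply: eq_bigr => j _ /=.
  by rewrite scalerDr -!scalerAl -!scalerAr !scalerA [w 0 i * _]mulrC.
rewrite /dot mulr_sumr scaler_suml; apply: eq_bigr => i _.
rewrite (bigD1 i) //= big1 => [|j /negPf nj].
  by rewrite HM eqxx mulr1 scalerA addr0 mulrC.
by rewrite HM nj mulr0 scale0r scaler0.
Qed.

Definition anticomm a b : clifford R n := a * b + b * a.

End CliffordRing.

Local Open Scope classical_set_scope.

(** * Smooth maps on the plane *)

Definition partial (R : realType) (V : normedModType R) (i : 'I_2)
    (F : 'rV[R]_2 -> V) (x : 'rV[R]_2) : V :=
  'D_(delta_mx 0 i) F x.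

(** For an open set A this is the usual notion of a C^oo map on A: all iterated
    partial derivatives exist and are differentiable, hence continuous. *)
Definition smooth_in (R : realType) (n : nat) (A : set 'rV[R]_2)
    (F : 'rV[R]_2 -> 'rV[R]_n) : Prop :=
  forall (s : seq 'I_2) (x : 'rV[R]_2), A x ->
    differentiable (foldr (@partial R 'rV[R]_n) F s) x.

(** * Smooth surfaces *)

(** [chart_inv] is only meaningful on the image of [chart_dom]. *)
Record chart (R : realType) (T : topologicalType) := Chart {
  chart_dom : set T;
  chart_map : T -> 'rV[R]_2;
  chart_inv : 'rV[R]_2 -> T }.

Definition is_chart (R : realType) (T : topologicalType) (c : chart R T) :=
  [/\ open (chart_dom c),
      open (chart_map c @` chart_dom c),
      forall p, chart_dom c p -> chart_inv c (chart_map c p) = p,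
      forall p, chart_dom c p -> {for p, continuous (chart_map c)} &
      forall x, (chart_map c @` chart_dom c) x ->
        {for x, continuous (chart_inv c)}].

Record smooth_surface (R : realType) := SmoothSurface {
  surface_sort :> topologicalType;
  atlas : set (chart R surface_sort);
  surface_hausdorff : hausdorff_space surface_sort;
  surface_second_countable : @second_countable surface_sort;
  atlas_chart : forall c, atlas c -> is_chart c;
  atlas_cover : forall p, exists2 c, atlas c & chart_dom c p;
  atlas_smooth : forall c d, atlas c -> atlas d ->
    smooth_in (chart_map c @` (chart_dom c `&` chart_dom d))
      (chart_map d \o chart_inv c) }.

Definition charts_at (R : realType) (M : smooth_surface R) (p : M) :
    set (chart R M) :=
  [set c | atlas c /\ chart_dom c p].

Definition smooth_on (R : realType) (n : nat) (M : smooth_surface R)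
    (U : set M) (F : M -> 'rV[R]_n) : Prop :=
  forall c, atlas c ->
    smooth_in (chart_map c @` (U `&` chart_dom c)) (F \o chart_inv c).

(** The value of dF at p on the i-th coordinate vector field of c. *)
Definition diff_chart (R : realType) (n : nat) (M : smooth_surface R)
    (c : chart R M) (i : 'I_2) (F : M -> 'rV[R]_n) (p : M) : 'rV[R]_n :=
  partial i (F \o chart_inv c) (chart_map c p).

(** * Immersed surfaces in local coordinates *)

Section ParametrisedSurface.
Variables (R : realType) (n : nat) (F : 'rV[R]_2 -> 'rV[R]_n).
Implicit Types (x : 'rV[R]_2) (i j k : 'I_2).

Definition jac x : 'M[R]_(2, n) := \matrix_(i < 2) partial i F x.

Definition first_form x : 'M[R]_2 :=
  \matrix_(i < 2, j < 2) dot (partial i F x) (partial j F x).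

(** Christoffel symbols Gamma^k_(i j) of the Levi-Civita connection of the
    induced metric. *)
Definition christoffel x i j k : R :=
  2^-1 * \sum_(l < 2) invmx (first_form x) k l *
    (partial i (fun y => first_form y j l : R^o) x
     + partial j (fun y => first_form y i l : R^o) x
     - partial l (fun y => first_form y i j : R^o) x).

(** (nabla dF)(d_i, d_j) *)
Definition nabla_diff x i j : 'rV[R]_n :=
  partial i (partial j F) x - \sum_(k < 2) christoffel x i j k *: partial k F x.

Definition mean_curvature_at x : 'rV[R]_n :=
  2^-1 *: \sum_(i < 2) \sum_(j < 2) invmx (first_form x) i j *: nabla_diff x i j.

(** Orthogonal projection onto the normal space at x. *)
Definition normal_part x (w : 'rV[R]_n) : 'rV[R]_n :=
  w - \sum_(i < 2) \sum_(j < 2)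
        (invmx (first_form x) i j * dot w (partial i F x)) *: partial j F x.

End ParametrisedSurface.

(** * Generalised H-surfaces *)

Section GeneralisedHSurface.
Variables (R : realType) (n : nat) (M : smooth_surface R).
Implicit Types (U V : set M) (f g N : M -> 'rV[R]_n) (c : chart R M) (p : M).

Definition immersed_at f p : Prop :=
  forall c, charts_at p c ->
    row_free (jac (f \o chart_inv c) (chart_map c p)).

Definition immersion_on U f : Prop :=
  smooth_on U f /\ forall p, U p -> immersed_at f p.

Definition mean_curvature c f p : 'rV[R]_n :=
  mean_curvature_at (f \o chart_inv c) (chart_map c p).

Definition unit_normal_section U f N : Prop :=
  smooth_on U N /\
  forall p, U p -> dot (N p) (N p) = 1 /\
    forall c, charts_at p c -> forall i, dot (diff_chart c i f p) (N p) = 0.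

Definition isoperimetric_section U f N (H : R) : Prop :=
  unit_normal_section U f N /\
  forall p, U p -> forall c, charts_at p c ->
    dot (mean_curvature c f p) (N p) = H.

Definition normal_parallel U f N : Prop :=
  forall p, U p -> forall c, charts_at p c -> forall i,
    normal_part (f \o chart_inv c) (chart_map c p) (diff_chart c i N p) = 0.

Definition generalised_H_surface U f (H : R) : Prop :=
  immersion_on U f /\
  exists N, isoperimetric_section U f N H /\ normal_parallel U f N.

(** On V, dg = r g (df^c) g - df, with products in the Clifford algebra. *)
Definition darboux_equation V (r : R) f fc g : Prop :=
  forall p, V p -> forall c, charts_at p c -> forall i,
    cl_vec (diff_chart c i g p) =
      r *: (cl_vec (g p) * cl_vec (diff_chart c i fc p) * cl_vec (g p))
      - cl_vec (diff_chart c i f p).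

(** f + g is a local Darboux transform D^v_r f on V, fc being the chosen
    Christoffel transform of f. *)
Definition darboux_solution V (o : M) (v : 'rV[R]_n) (r : R) f fc g : Prop :=
  [/\ smooth_on V g,
      forall p, V p -> g p != 0,
      darboux_equation V r f fc g &
      g o = v - f o].

End GeneralisedHSurface.

(* Main.v *)
Require Import Defs.
From HB Require Import structures.
From mathcomp Require Import all_boot all_order all_algebra.
From mathcomp Require Import all_classical all_reals all_analysis.
From mathcomp Require Import ring lra.

(** Write [q = r |g|^2] and let [rho] be the reflection in the hyperplane
    orthogonal to [g].  Since [g w g = |g|^2 rho w] for a vector [w], the Darboux
    equation reads [d(f+g) = q rho(d(f^c))].  The normal field of [f+g] is
    [rho N].  The function [phi = 2 r (g,N) - r H |g|^2] satisfies
    [d phi = - 2 r (g, d(f^c)) (phi - 1)], so the initial condition [phi = 1]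
    persists on [V].  Then [rho N = N - H g - g / q], whence
    [d(rho N) = q^-1 rho(df) - H d(f+g)].
    If [S] is the matrix of [d(f^c)] in terms of [df], then [tr S = 0], and
    [d(rho N)] has matrix [q^-2 S^-1 - H] in terms of [d(f+g)].  So [rho N] is
    parallel, and its mean curvature component is [H] because a traceless
    invertible 2 x 2 matrix has traceless inverse. *)

Set Implicit Arguments.
Unset Strict Implicit.
Unset Printing Implicit Defensive.

Import Order.TTheory GRing.Theory Num.Theory.
Import numFieldNormedType.Exports.

Local Open Scope classical_set_scope.
Local Open Scope ring_scope.

(** * Euclidean and Clifford algebra *)

Section Dot.
Variables (R : realType) (n : nat).
Implicit Types (u v w g : 'rV[R]_n) (a : R).

Lemma dotE u v : dot u v = (u *m v^T) 0 0.
Proof. by rewrite /dot mxE; apply: eq_bigr => i _; rewrite mxE. Qed.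

Lemma dotC u v : dot u v = dot v u.
Proof. by apply: eq_bigr => i _; rewrite mulrC. Qed.

Lemma dotDl u v w : dot (u + v) w = dot u w + dot v w.
Proof. by rewrite !dotE mulmxDl mxE. Qed.

Lemma dotZl a u v : dot (a *: u) v = a * dot u v.
Proof. by rewrite !dotE -scalemxAl mxE. Qed.

Lemma dotNl u v : dot (- u) v = - dot u v.
Proof. by rewrite !dotE mulNmx mxE. Qed.

Lemma dotDr u v w : dot u (v + w) = dot u v + dot u w.
Proof. by rewrite !(dotC u) dotDl. Qed.

Lemma dotZr a u v : dot u (a *: v) = a * dot u v.
Proof. by rewrite !(dotC u) dotZl. Qed.

Lemma dotNr u v : dot u (- v) = - dot u v.
Proof. by rewrite !(dotC u) dotNl. Qed.

Definition dot_simpl := (dotDl, dotDr, dotZl, dotZr, dotNl, dotNr).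

Lemma dot_gt0 u : (0 < dot u u) = (u != 0).
Proof.
have sq_ge0 i : 0 <= u 0 i * u 0 i by rewrite -expr2 sqr_ge0.
rewrite lt_neqAle sumr_ge0 ?andbT => [|i _]; last exact: sq_ge0.
rewrite eq_sym; congr (~~ _).
rewrite psumr_eq0 => [|i _]; last exact: sq_ge0.
apply/allP/eqP => [u0|-> i _]; last by rewrite mxE mul0r eqxx.
apply/rowP => i; rewrite mxE; apply/eqP.
by have := u0 i (mem_index_enum i); rewrite mulf_eq0 orbb.
Qed.

Definition reflection g u : 'rV[R]_n := u - (2 * dot u g / dot g g) *: g.

Lemma dot_reflection g u v : g != 0 ->
  dot (reflection g u) (reflection g v) = dot u v.
Proof.
rewrite -dot_gt0 => /lt0r_neq0 g0.
by rewrite /reflection !dot_simpl (dotC g v); field.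
Qed.

End Dot.

Section CliffordVectors.
Variables (R : realType) (n : nat).
Implicit Types (u v w g : 'rV[R]_n) (a : R).

Lemma cl_vecD u v : cl_vec (u + v) = cl_vec u + cl_vec v.
Proof.
by rewrite /cl_vec -big_split; apply: eq_bigr => i _; rewrite mxE scalerDl.
Qed.

Lemma cl_vecZ a u : cl_vec (a *: u) = a *: cl_vec u.
Proof.
by rewrite /cl_vec scaler_sumr; apply: eq_bigr => i _; rewrite mxE scalerA.
Qed.

Lemma cl_vecB u v : cl_vec (u - v) = cl_vec u - cl_vec v.
Proof. by rewrite -scaleN1r cl_vecD cl_vecZ scaleN1r. Qed.

Lemma cl_vec_inj : injective (@cl_vec R n).
Proof.
move=> u v /ffunP uv; apply/rowP => i.
suff coord w : cl_vec w [set i]%SET = w 0 i by rewrite -!coord uv.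
rewrite /cl_vec sum_ffunE (bigD1 i) //= big1 => [|j /negPf ji].
  by rewrite !ffunE eqxx addr0 /GRing.scale /= mulr1.
by rewrite !ffunE (inj_eq set1_inj) eq_sym ji scaler0.
Qed.

Lemma cl_scalar_inj a b : a%:A = b%:A :> clifford R n -> a = b.
Proof.
move/eqP; rewrite -subr_eq0 -scalerBl scaler_eq0 oner_eq0 orbF subr_eq0.
by move/eqP.
Qed.

Lemma cl_vec_sqr u : cl_vec u * cl_vec u = (- dot u u)%:A.
Proof.
apply: (scalerI (_ : (2 : R) != 0)); first by rewrite pnatr_eq0.
by rewrite scalerA mulrN -mulNr -cl_vec_clifford scaler_nat mulr2n.
Qed.

(** Moving [g] past [w] by the Clifford relation leaves [- w g^2 - 2 (g,w) g], and [g^2 = - |g|^2].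
    This turns the Clifford products of the Darboux equation into Euclidean geometry. *)
Lemma cl_vec_sandwich g w :
  cl_vec g * cl_vec w * cl_vec g = cl_vec (dot g g *: reflection g w).
Proof.
(* The factor [dot g g] clears the denominator of the reflection; for [g = 0] both sides vanish. *)
have -> : dot g g *: reflection g w = dot g g *: w - (2 * dot g w) *: g.
  rewrite scalerBr scalerA dotC; have [->|] := eqVneq g 0.
    by rewrite !scaler0.
  by rewrite -dot_gt0 => /lt0r_neq0 g0; congr (_ - _ *: _); field.
rewrite cl_vecB !cl_vecZ.
have -> : cl_vec g * cl_vec w = (- 2 * dot g w)%:A - cl_vec w * cl_vec g.
  by rewrite -cl_vec_clifford addrK.
rewrite mulrBl -mulrA cl_vec_sqr -scalerAl mul1r -scalerAr mulr1.
by rewrite scaleNr opprK mulNr scaleNr addrC.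
Qed.

End CliffordVectors.

(** * Gram matrices and Weingarten matrices *)

Section ShapeMatrix.
Variables (R : realType) (n : nat).

(** If [u] kills [J J^T], then [|u J|^2 = u J J^T u^T = 0], so [u J = 0] and [u = 0]. Applied to a
    Jacobian, this makes the first fundamental form invertible. *)
Lemma gram_unitmx (J : 'M[R]_(2, n)) : row_free J -> J *m J^T \in unitmx.
Proof.
move=> Jfree; rewrite -row_free_unit -kermx_eq0; apply/rowV0P => u.
move=> /sub_kermxP uJJ; apply/eqP; rewrite -(mulmx_free_eq0 u Jfree).
apply: contraT; rewrite -dot_gt0 dotE trmx_mul mulmxA -(mulmxA u) uJJ.
by rewrite mul0mx mxE ltxx.
Qed.

(** The adjugate of a 2 x 2 matrix swaps the diagonal entries, hence keeps the trace, and the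
    inverse is a multiple of it. A singular [S] is its own [invmx]. *)
Lemma trace_invmx2 (S : 'M[R]_2) : \tr S = 0 -> \tr (invmx S) = 0.
Proof.
rewrite /invmx; case: ifP => // Su; rewrite linearZ /= /mxtrace.
rewrite !big_ord_recl !big_ord0 !addr0 => trS.
rewrite !mxE /cofactor !det_mx11 !mxE /= mul1r sqrrN expr1n mul1r.
have -> : lift (lift ord0 ord0) 0 = ord0 :> 'I_2 by apply/val_inj.
have -> : lift ord0 0 = lift ord0 ord0 :> 'I_2 by apply/val_inj.
by rewrite addrC trS mulr0.
Qed.

(** The Gram matrix cancels and leaves [L^T]. With [L J] the Jacobian of a normal field, the left
    side is the trace occurring in the mean curvature. *)
Lemma trace_shape_operator (J : 'M[R]_(2, n)) (L : 'M[R]_2) : row_free J ->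
  \tr (invmx (J *m J^T) *m (J *m (L *m J)^T)) = \tr L.
Proof.
move=> /gram_unitmx Iu.
by rewrite trmx_mul (mulmxA J) (mulmxA (invmx _)) mulVmx // mul1mx mxtrace_tr.
Qed.

(** Here [X] stands for the reflected Jacobian of [f], so that [q *: (S *m X)] is the Jacobian of
    [f + g] and the left side of the equation is that of the new normal. As [S X] has rank two, so
    has [S]; the witness [q^-2 S^-1 - H] has a traceless first term. *)
Lemma shape_darboux (X : 'M[R]_(2, n)) (S : 'M[R]_2) (q H : R) :
    q != 0 -> \tr S = 0 -> row_free (q *: (S *m X)) ->
  exists2 L, q^-1 *: X - H *: (q *: (S *m X)) = L *m (q *: (S *m X))
           & \tr L = - (2 * H).
Proof.
move=> q0 trS free; have Su : S \in unitmx.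
  rewrite -row_free_unit -row_leq_rank.
  apply: (leq_trans _ (mxrankM_maxl S X)).
  by rewrite -(eqmx_scale (S *m X) q0) row_leq_rank.
exists (q ^- 2 *: invmx S - H%:M).
  rewrite mulmxBl mul_scalar_mx -scalemxAr -scalemxAl mulKmx //.
  by rewrite [q *: (_ *: X)]scalerA; congr (_ *: _ - _); field.
rewrite linearB /= linearZ /= trace_invmx2 // mulr0 sub0r.
by rewrite mxtrace_scalar mulr_natl.
Qed.

End ShapeMatrix.

(** * Pointwise algebra of the Darboux equation *)

Section DarbouxAlgebra.
Variables (R : realType) (n : nat) (r H : R) (g df dN dg : 'rV[R]_n).
Hypotheses (g0 : g != 0) (r0 : r != 0).
Hypothesis dgE : dg = (r * dot g g) *: reflection g (H *: df + dN) - df.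

Let gg0 : dot g g != 0. Proof. by apply: lt0r_neq0; rewrite dot_gt0. Qed.

(** Put [w = H df + dN], which is orthogonal to [N]. Then [(dg,N) = - 2 r (g,w) (g,N)] and
    [(dg,g) = - r |g|^2 (g,w) - (g,df)]; the leftover [2 r (g,dN) + 2 r H (g,df)] is [2 r (g,w)],
    which accounts for the final [- 1]. *)
Lemma darboux_defect_algebra N : dot df N = 0 -> dot dN N = 0 ->
  2 * r * (dot dg N + dot g dN) - r * H * (2 * dot dg g) =
  - (2 * r * dot g (H *: df + dN))
    * (2 * r * dot g N - r * H * dot g g - 1).
Proof.
move=> dfN dNN; rewrite dgE /reflection !dot_simpl dfN dNN.
rewrite (dotC df g) (dotC dN g); by field.
Qed.

(** The left side is the derivative of [N - H g - k g], since [dk = - k^2 r 2 (dg,g)]. With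
    [w = H df + dN] and [rho] the reflection, the term in [k ^+ 2] contributes
    [(rho w - w) + k (rho df - df)], after which most terms cancel. *)
Lemma darboux_normal_algebra (k := (r * dot g g)^-1) :
  dN - H *: dg - (k *: dg - (k ^+ 2 * (r * (2 * dot dg g))) *: g) =
  k *: reflection g df - H *: ((r * dot g g) *: reflection g (H *: df + dN)).
Proof.
rewrite dgE /reflection !dot_simpl /k; apply/rowP => j; rewrite !mxE.
by rewrite (dotC df g) (dotC dN g); field; rewrite r0 gg0.
Qed.

End DarbouxAlgebra.

(** * Immersions in coordinates *)

Section DotDerivative.
Variables (R : realType) (n : nat) (V : normedModType R).
Implicit Types (F G : V -> 'rV[R]_n) (x v : V).

Lemma differentiable_rVP F x :
  differentiable F x <-> forall j, differentiable (fun y => F y 0 j : R^o) x.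
Proof.
split=> [dF j|dF].
  exact: (differentiable_comp dF (differentiable_coord _ _ _)).
have -> : F = \sum_(j < n) (fun y => F y 0 j *: delta_mx 0 j).
  by apply/funext => y; rewrite fct_sumE -row_sum_delta.
by apply: differentiable_sum => j; exact: differentiableZl.
Qed.

Lemma derive_coord F x v j : differentiable F x ->
  'D_v (fun y => F y 0 j : R^o) x = 'D_v F x 0 j.
Proof. by move=> dF; rewrite derive_mx ?mxE //; exact: diff_derivable. Qed.

Lemma is_derive_dot F G x v : differentiable F x -> differentiable G x ->
  is_derive x v (fun y => dot (F y) (G y) : R^o)
    (dot ('D_v F x) (G x) + dot (F x) ('D_v G x)).
Proof.
move=> dF dG.
have -> : (fun y => dot (F y) (G y) : R^o)
    = \sum_(j < n) ((fun y => F y 0 j : R^o) * (fun y => G y 0 j : R^o)).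
  by apply/funext => y; rewrite fct_sumE.
rewrite /dot -big_split /=; apply: is_derive_sum => j.
have dFj : is_derive x v (fun y => F y 0 j : R^o) ('D_v F x 0 j).
  rewrite -derive_coord //; apply/derivableP/diff_derivable.
  exact: (differentiable_rVP _ _).1 dF j.
have dGj : is_derive x v (fun y => G y 0 j : R^o) ('D_v G x 0 j).
  rewrite -derive_coord //; apply/derivableP/diff_derivable.
  exact: (differentiable_rVP _ _).1 dG j.
apply: is_derive_eq; rewrite /GRing.scale /=; ring.
Qed.

End DotDerivative.

Section LocalGeometry.
Variables (R : realType) (n : nat).
Implicit Types (F G : 'rV[R]_2 -> 'rV[R]_n) (x : 'rV[R]_2).

Lemma row_jac F x i : row i (jac F x) = partial i F x.
Proof. exact: rowK. Qed.

Lemma first_formE F x : first_form F x = jac F x *m (jac F x)^T.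
Proof.
apply/matrixP => i j; rewrite !mxE; apply: eq_bigr => k _.
by rewrite !mxE.
Qed.

Lemma normal_partE F x w : normal_part F x w =
  w - w *m (jac F x)^T *m invmx (first_form F x) *m jac F x.
Proof.
congr (_ - _); rewrite [RHS]mulmx_sum_row exchange_big /=.
apply: eq_bigr => j _; rewrite row_jac -scaler_suml; congr (_ *: _).
rewrite mxE; apply: eq_bigr => i _; rewrite mulrC mxE; congr (_ * _).
by apply: eq_bigr => k _; rewrite !mxE.
Qed.

Lemma normal_part_tangent F x (u : 'rV[R]_2) : row_free (jac F x) ->
  normal_part F x (u *m jac F x) = 0.
Proof.
move=> /gram_unitmx; rewrite normal_partE -first_formE => Iu.
by rewrite -(mulmxA u) -first_formE mulmxK // subrr.
Qed.

(** Each row of [jac G x] equals its tangential projection, and the projection formula supplies [L].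
    For a parallel normal field it is the Weingarten matrix. *)
Lemma normal_part_eq0 F G x :
    (forall i, normal_part F x (partial i G x) = 0) ->
  exists L, jac G x = L *m jac F x.
Proof.
move=> np0; exists (jac G x *m (jac F x)^T *m invmx (first_form F x)).
apply/row_matrixP => i; move/eqP: (np0 i); rewrite normal_partE subr_eq0.
by rewrite !row_mul !row_jac => /eqP.
Qed.

(** Pairing with the normal [N] kills the Christoffel terms of [nabla_diff], which are tangent, so
    only second derivatives of [F] remain. *)
Lemma mean_curvature_dot F N (A : set 'rV[R]_2) x : open A -> A x ->
    (forall i, differentiable (partial i F) x) -> differentiable N x ->
    (forall y, A y -> forall i, dot (partial i F y) (N y) = 0) ->
  dot (mean_curvature_at F x) (N x) =
    - (2^-1 * \tr (invmx (first_form F x) *m (jac F x *m (jac N x)^T))).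
Proof.
move=> Aopen Ax dF dN FN0; rewrite dotZl -mulrN; congr (_ * _).
have sum_dot (u : 'I_2 -> 'rV[R]_n) w : dot (\sum_i u i) w = \sum_i dot (u i) w.
  by elim/big_rec2: _ => [|i y z _ <-]; rewrite ?dotDl // dotE mul0mx mxE.
rewrite sum_dot -sumrN; apply: eq_bigr => i _.
rewrite sum_dot mxE -sumrN; apply: eq_bigr => j _.
rewrite dotZl -mulrN; congr (_ * _).
rewrite /nabla_diff dotDl dotNl sum_dot big1 ?subr0 => [|k _]; last first.
  by rewrite dotZl FN0 // mulr0.
(* Differentiating [(d_j F, N) = 0] gives [(d_i d_j F, N) = - (d_j F, d_i N)]. *)
have := is_derive_dot (delta_mx 0 i) (dF j) dN => /(@derive_val _ _ _ _ _ _ _).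
have -> : 'D_(delta_mx 0 i) (fun y => dot (partial j F y) (N y) : R^o) x = 0.
  rewrite (near_eq_derive (g := cst 0)) ?derive_cst //.
  by apply: filterS (open_nbhs_nbhs (conj Aopen Ax)) => y Ay; rewrite FN0.
move=> /esym/eqP; rewrite addr_eq0 => /eqP ->; congr (- _).
by rewrite mxE; apply: eq_bigr => k _; rewrite !mxE.
Qed.

End LocalGeometry.

(** * Smooth maps on plane domains *)

(** The difference [g - f] vanishes near [x], hence is a little-o of the increment and has zero
    differential; adding [f] back gives [g]. *)
Lemma near_eq_differentiable (R : realType) (V W : normedModType R)
    (f g : V -> W) (x : V) :
  (\near x, f x = g x) -> differentiable f x -> differentiable g x.
Proof.
move=> fg df; suff d0 : differentiable (g - f) x.
  by rewrite -(subrK f g); exact: differentiableD.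
have e : (g - f) \o shift x = cst ((g - f) x) + \0 +o_ 0 id.
  apply/eqaddoP => _/posnumP[e]; near=> h.
  have -> : ((g - f) \o shift x - (cst ((g - f) x) + \0)) h = 0.
    rewrite !fctE /= (nbhs_singleton fg) subrr addr0 subr0.
    suff -> : f (h + x) = g (h + x) by rewrite subrr.
    near: h; have := fg; rewrite (near_shift 0) /=.
    by apply: filterS => h; rewrite /= subr0.
  by rewrite normr0 mulr_ge0.
have c0 : continuous (\0 : {linear V -> W}) by exact: cst_continuous.
by apply/diff_locallyP; rewrite (diff_unique c0 e).
Unshelve. all: by end_near. Qed.

Section Smooth.
Variables (R : realType) (A : set 'rV[R]_2).
Hypothesis Aopen : open A.

(** Counting orders of differentiability allows the product and quotient rules to be proved by
    induction on [k]. A general target [V] covers scalar functions such as inner products. *)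
Fixpoint smooth_upto (V : normedModType R) (k : nat) (F : 'rV[R]_2 -> V) :=
  (forall x, A x -> differentiable F x) /\
  (if k is k'.+1 then forall i, smooth_upto k' (partial i F) else True).

Lemma smooth_upto_differentiable (V : normedModType R) k (F : 'rV[R]_2 -> V) x :
  smooth_upto k F -> A x -> differentiable F x.
Proof. by case: k => [|k] [dF _] /dF. Qed.

Lemma smooth_uptoW (V : normedModType R) k (F : 'rV[R]_2 -> V) :
  smooth_upto k.+1 F -> smooth_upto k F.
Proof.
elim: k F => [|k IHk] F [dF sF]; first by split.
by split=> // i; exact: IHk (sF i).
Qed.

Lemma eq_smooth_upto (V : normedModType R) k (F G : 'rV[R]_2 -> V) :
  (forall x, A x -> F x = G x) -> smooth_upto k F -> smooth_upto k G.
Proof.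
have nearA x : A x -> \near x, A x by move=> Ax; exact: open_nbhs_nbhs.
elim: k F G => [|k IHk] F G FG [dF sF].
  split=> // x Ax; apply: near_eq_differentiable (dF x Ax).
  by apply: filterS (nearA x Ax) => y /FG.
split=> [x Ax|i].
  apply: near_eq_differentiable (dF x Ax).
  by apply: filterS (nearA x Ax) => y /FG.
apply: IHk (sF i) => x Ax; apply: near_eq_derive.
by apply: filterS (nearA x Ax) => y /FG.
Qed.

(** In [foldr] the derivative taken first is the one along the last index of [s], while
    [smooth_upto] peels off the derivative taken first; hence the induction from the right end of
    [s]. *)
Lemma smooth_in_upto n (F : 'rV[R]_2 -> 'rV[R]_n) :
  smooth_in A F <-> forall k, smooth_upto k F.
Proof.
split=> [sF k|sF s x Ax].
  elim: k F sF => [|k IHk] F sF; first by split=> // x; exact: (sF [::]).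
  split=> [x|i]; first exact: (sF [::]).
  by apply: IHk => s x Ax; rewrite -foldr_rcons; exact: sF.
have {sF} := sF (size s); elim/last_ind: s F => [|s i IHs] F.
  by move/smooth_upto_differentiable; exact.
by rewrite size_rcons => -[_ /(_ i) /IHs]; rewrite foldr_rcons.
Qed.

Lemma smooth_upto_cst (V : normedModType R) k (w : V) :
  smooth_upto k (fun _ => w).
Proof.
elim: k w => [|k IHk] w; first by split=> // x _; exact: differentiable_cst.
split=> [x _|i]; first exact: differentiable_cst.
by apply: eq_smooth_upto (IHk 0) => x _; rewrite /partial derive_cst.
Qed.

Lemma smooth_uptoD (V : normedModType R) k (F G : 'rV[R]_2 -> V) :
  smooth_upto k F -> smooth_upto k G -> smooth_upto k (F \+ G).
Proof.
elim: k F G => [|k IHk] F G [dF sF] [dG sG].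
  by split=> // x Ax; apply: differentiableD; [exact: dF | exact: dG].
split=> [x Ax|i]; first by apply: differentiableD; [exact: dF | exact: dG].
apply: eq_smooth_upto (IHk _ _ (sF i) (sG i)) => x Ax.
by rewrite /partial deriveD //; apply: diff_derivable; [exact: dF | exact: dG].
Qed.

Lemma smooth_upto_sum (V : normedModType R) k (I : Type) (r : seq I)
    (F : I -> 'rV[R]_2 -> V) :
  (forall i, smooth_upto k (F i)) ->
  smooth_upto k (fun x => \sum_(i <- r) F i x).
Proof.
move=> sF; elim: r => [|i r IHr].
  by apply: eq_smooth_upto (smooth_upto_cst k 0) => x _; rewrite big_nil.
by apply: eq_smooth_upto (smooth_uptoD (sF i) IHr) => x _; rewrite big_cons.
Qed.

(** In the Leibniz rule the undifferentiated factor is needed to order [k] only, hence the lowering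
    by [smooth_uptoW]. *)
Lemma smooth_uptoM k (F G : 'rV[R]_2 -> R^o) :
  smooth_upto k F -> smooth_upto k G ->
  smooth_upto k (fun x => F x * G x : R^o).
Proof.
elim: k F G => [|k IHk] F G sF sG.
  case: sF sG => [dF _] [dG _].
  by split=> // x Ax; apply: differentiableM; [exact: dF | exact: dG].
have [[dF dF'] [dG dG']] := (sF, sG).
split=> [x Ax|i]; first by apply: differentiableM; [exact: dF | exact: dG].
apply: eq_smooth_upto (smooth_uptoD (IHk _ _ (smooth_uptoW sF) (dG' i))
  (IHk _ _ (smooth_uptoW sG) (dF' i))) => x Ax.
by rewrite /partial deriveM //; apply: diff_derivable; [exact: dF | exact: dG].
Qed.

(** The derivative [- (1/F)^2 dF] involves [1/F] only to the order already known by induction. *)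
Lemma smooth_uptoV k (F : 'rV[R]_2 -> R^o) :
  (forall x, A x -> F x != 0) -> smooth_upto k F ->
  smooth_upto k (fun x => (F x)^-1 : R^o).
Proof.
move=> F0; elim: k => [|k IHk] sF.
  by split=> // x Ax; apply: differentiableV; [exact: (sF.1) | exact: F0].
have [dF dF'] := sF.
split=> [x Ax|i]; first by apply: differentiableV; [exact: dF | exact: F0].
have sV := IHk (smooth_uptoW sF).
apply: eq_smooth_upto (smooth_uptoM (smooth_uptoM
  (smooth_upto_cst k (-1 : R^o)) (smooth_uptoM sV sV)) (dF' i)) => x Ax.
rewrite /partial deriveV; [|exact: F0|by apply: diff_derivable; exact: dF].
by rewrite mulN1r -invfM -expr2.
Qed.

Lemma smooth_upto_rVP n k (F : 'rV[R]_2 -> 'rV[R]_n) :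
  smooth_upto k F <-> forall j, smooth_upto k (fun x => F x 0 j : R^o).
Proof.
elim: k F => [|k IHk] F.
  split=> [[dF _] j|sF]; split=> // x Ax.
    by apply: (differentiable_rVP _ _).1; exact: dF.
  by apply/differentiable_rVP => j; exact: (sF j).1.
split=> [[dF sF] j|sF].
  split=> [x Ax|i]; first by apply: (differentiable_rVP _ _).1; exact: dF.
  apply: eq_smooth_upto ((IHk _).1 (sF i) j) => x Ax.
  by rewrite /partial derive_coord //; exact: dF.
have dF x : A x -> differentiable F x.
  by move=> Ax; apply/differentiable_rVP => j; exact: (sF j).1.
split=> // i; apply/IHk => j; apply: eq_smooth_upto ((sF j).2 i) => x Ax.
by rewrite /partial derive_coord //; exact: dF.
Qed.

Lemma smooth_upto_dot n k (F G : 'rV[R]_2 -> 'rV[R]_n) :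
  smooth_upto k F -> smooth_upto k G ->
  smooth_upto k (fun x => dot (F x) (G x) : R^o).
Proof.
move=> /smooth_upto_rVP sF /smooth_upto_rVP sG.
by apply: smooth_upto_sum => j; exact: smooth_uptoM.
Qed.

Lemma smooth_uptoZ n k (a : 'rV[R]_2 -> R^o) (F : 'rV[R]_2 -> 'rV[R]_n) :
  smooth_upto k a -> smooth_upto k F ->
  smooth_upto k (fun x => a x *: F x).
Proof.
move=> sa /smooth_upto_rVP sF; apply/smooth_upto_rVP => j.
by apply: eq_smooth_upto (smooth_uptoM sa (sF j)) => x _; rewrite mxE.
Qed.

Lemma smooth_inD n (F G : 'rV[R]_2 -> 'rV[R]_n) :
  smooth_in A F -> smooth_in A G -> smooth_in A (F \+ G).
Proof.
move=> /smooth_in_upto sF /smooth_in_upto sG; apply/smooth_in_upto => k.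
exact: smooth_uptoD.
Qed.

Lemma differentiable_dot n (F G : 'rV[R]_2 -> 'rV[R]_n) x : A x ->
  smooth_in A F -> smooth_in A G ->
  differentiable (fun y => dot (F y) (G y) : R^o) x.
Proof.
move=> Ax /smooth_in_upto sF /smooth_in_upto sG.
apply: (smooth_upto_differentiable (k := 0)) Ax; exact: smooth_upto_dot.
Qed.

End Smooth.

(** * Linear first-order systems *)

(** A Gronwall argument: [k = h^2 exp(- 2 K t)] has derivative [2 (a - K) h^2 exp(- 2 K t)], which
    is nonpositive, so [k 1 <= k 0 = 0] and [h 1 ^ 2 <= 0]. *)
Lemma linear_ode_eq0 (R : realType) (h a : R -> R) (K : R) :
    (forall t : R, 0 <= t <= 1 -> is_derive t 1 h (a t * h t)) ->
    (forall t : R, 0 <= t <= 1 -> `|a t| <= K) ->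
  h 0 = 0 -> h 1 = 0.
Proof.
move=> dh aK h0; pose k := (h * h) * (expR \o ( *%R (- (2 * K)))).
have dk (t : R) : 0 <= t <= 1 ->
    is_derive t 1 k (2 * (a t - K) * h t ^+ 2 * expR (- (2 * K) * t)).
  move=> t01; have dht := dh t t01.
  have dl : is_derive t 1 ( *%R (- (2 * K)) : R -> R) (- (2 * K)).
    apply: is_derive_eq (is_deriveZ _ (is_derive_id _ _)) _.
    by rewrite /GRing.scale /= mulr1.
  have de : is_derive t 1 (expR \o ( *%R (- (2 * K))) : R -> R)
      (- (2 * K) * expR (- (2 * K) * t)).
    by rewrite [_ * expR _]mulrC; exact: is_derive1_comp.
  by apply: is_derive_eq; rewrite /GRing.scale /= fctE; ring.
have k1 : k 1 <= k 0.
  apply: (@ler0_derive1_nincr R k 0 1) => //.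
  - move=> t /[!in_itv] /= /andP[/ltW t0 /ltW t1].
    by have [|//] := dk t; rewrite t0.
  - move=> t /[!in_itv] /= /andP[/ltW t0 /ltW t1].
    have [|_ dkt] := dk t; first by rewrite t0.
    rewrite derive1E dkt.
    have := aK t; rewrite t0 t1 => /(_ isT)/(le_trans (ler_norm _)) atK.
    by rewrite mulr_le0_ge0 ?expR_ge0 // mulr_le0_ge0 ?sqr_ge0 //; lra.
  - apply: derivable_within_continuous => t /[!in_itv] /= t01.
    by have [] := dk t t01.
have : h 1 * h 1 <= 0.
  move: k1; rewrite /k !fctE /= h0 !mul0r pmulr_lle0 ?expR_gt0 //.
by rewrite -expr2 => h1; apply/eqP; rewrite -sqrf_eq0 eq_le h1 sqr_ge0.
Qed.

Lemma ball_segment (R : realType) (V : normedModType R) (x y z : V) (e t : R) :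
  ball x e y -> ball x e z -> 0 <= t <= 1 -> ball x e (y + t *: (z - y)).
Proof.
rewrite -ball_normE /= => xy xz /andP[t0 t1].
have -> : x - (y + t *: (z - y)) = (1 - t) *: (x - y) + t *: (x - z).
  rewrite scalerBl scale1r -addrA [- _ + _]addrC -scalerBr opprB.
  by rewrite [x - z + _]addrC subrKA opprD addrA -scalerN opprB.
(* The strict bound on the second summand needs [t > 0], so [t = 0] is treated apart. *)
have [->|tn0] := eqVneq t 0; first by rewrite subr0 scale1r scale0r addr0.
rewrite (le_lt_trans (ler_normD _ _)) // !normrZ ger0_norm ?subr_ge0 //.
rewrite ger0_norm // -[ltRHS]mul1r -[X in X * e](subrK t) [ltRHS]mulrDl.
rewrite ler_ltD ?ler_wpM2l ?subr_ge0 ?(ltW xy) // ltr_pM2l //.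
by rewrite lt_def tn0.
Qed.

(** Along a segment in the ball with direction [v], [psi] solves a linear ordinary equation with
    coefficient the sum of the [v_i b_i], so a zero at one end forces a zero at the other. *)
Lemma linear_pde_eq0 (R : realType) (A : set 'rV[R]_2) (psi : 'rV[R]_2 -> R^o)
    (b : 'I_2 -> 'rV[R]_2 -> R^o) (x : 'rV[R]_2) : open A -> A x ->
    (forall y, A y -> differentiable psi y) ->
    (forall y i, A y -> partial i psi y = b i y * psi y) ->
    (forall i, {for x, continuous (b i)}) ->
  exists2 e, 0 < e & ball x e `<=` A /\
    forall y z, ball x e y -> ball x e z -> psi y = 0 -> psi z = 0.
Proof.
move=> Aopen Ax dpsi ppsi cb.
(* Continuity at [x] gives a radius on which the [b i] are bounded by constants; this yields the
   uniform bound [K] along segments. *)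
have /nbhs_ballP[e /= e0 eA] :
    nbhs x (fun y => A y /\ forall i, `|b i y| <= `|b i x| + 1).
  near=> y; split; first by near: y; exact: open_nbhs_nbhs.
  near: y; apply: filter_forall => i.
  have /cvgrPdist_le/(_ 1 ltr01) := cb i; apply: filterS => y.
  rewrite distrC => bxy; rewrite addrC -lerBlDr.
  exact: le_trans (lerB_dist _ _) bxy.
exists e => //; split=> [y /eA[]//|y z xy xz psiy].
pose v := z - y; pose l (t : R) : 'rV[R]_2 := y + t *: v.
have xl (t : R) : 0 <= t <= 1 -> ball x e (l t) by exact: ball_segment.
suff : (psi \o l) 1 = 0 by rewrite /l /v /= scale1r addrC subrK.
apply: (@linear_ode_eq0 _ _ (fun t => \sum_i v 0 i * b i (l t))
  (\sum_i `|v 0 i| * (`|b i x| + 1))) => [t t01|t t01|].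
- have [Al _] := eA _ (xl t t01).
  have dl : is_diff t l ( *:%R ^~ v).
    by apply: is_diff_eq; rewrite add0r.
  have dlt : differentiable l t by exact: ex_diff.
  have dpl := differentiable_comp dlt (dpsi _ Al).
  apply: DeriveDef; first exact: diff_derivable.
  rewrite deriveE // (diff_comp dlt (dpsi _ Al)).
  rewrite /= diff_val scale1r {1}[v]row_sum_delta linear_sum mulr_suml.
  apply: eq_bigr => i _; rewrite linearZ /= -deriveE; last exact: dpsi.
  by rewrite -[LHS]/(v 0 i * partial i psi (l t)) ppsi // mulrA.
- apply: (le_trans (ler_norm_sum _ _ _)); apply: ler_sum => i _.
  by rewrite normrM ler_wpM2l //; exact: (eA _ (xl t t01)).2.
- by rewrite /l /= scale0r addr0.
Unshelve. all: by end_near. Qed.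

(** The local hypothesis is symmetric in [q] and [s], so it passes to the complement of [P]. Thus
    [V] splits into the disjoint open sets [Z] and [Z'], and [Z] contains [o]. *)
Lemma connected_locally_constant (T : topologicalType) (V P : set T) (o : T) :
    open V -> connected V -> V o -> P o ->
    (forall p, V p -> exists2 U, open_nbhs p U &
      forall q s, U q -> U s -> P q -> P s) ->
  forall p, V p -> P p.
Proof.
move=> Vopen Vconn Vo Po Ploc p Vp.
pose Z := V `&` P; pose Z' := V `&` ~` P.
have loc (Q : set T) : (forall p, V p -> exists2 U, open_nbhs p U &
    forall q s, U q -> U s -> Q q -> Q s) -> open (V `&` Q).
  move=> Qloc; rewrite openE => q [Vq Qq]; have [U [Uo Uq] UQ] := Qloc q Vq.
  apply: filterS (open_nbhs_nbhs (conj (openI Vopen Uo) (conj Vq Uq))).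
  by move=> s [Vs Us]; split=> //; exact: (UQ q s).
have Zopen : open Z by exact: loc.
have Z'open : open Z'.
  apply: loc => q Vq; have [U Uo UP] := Ploc q Vq.
  by exists U => // s t Us Ut nPs Pt; exact/nPs/(UP t s).
suff : Z = V by move=> ZV; have : Z p by [rewrite ZV]; case.
apply: Vconn; first by exists o.
- by exists Z => //; rewrite /Z setIA setIid.
- exists (~` Z'); first exact: open_closedC.
  apply/seteqP; split=> [q [Vq Pq]|q [Vq nZ']]; first by split=> // -[].
  by split=> //; apply: contrapT => nPq; apply: nZ'.
Qed.

(** * Darboux transforms *)

(** The coordinate derivative of the Christoffel transform [f^c]. *)
Definition dual_partial (R : realType) (n : nat) (H : R)
    (f N : 'rV[R]_2 -> 'rV[R]_n) (i : 'I_2) (x : 'rV[R]_2) : 'rV[R]_n :=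
  H *: partial i f x + partial i N x.

(** Since [g^2 = - |g|^2] and [{g,N} = - 2 (g,N)], this is the scalar [r H g^2 - r {g,N} - 1], whose
    vanishing at [o] is the initial condition. The domain [T] is either the surface or a coordinate
    plane. *)
Definition darboux_defect (R : realType) (n : nat) (T : Type) (r H : R)
    (N g : T -> 'rV[R]_n) (x : T) : R :=
  2 * r * dot (g x) (N x) - r * H * dot (g x) (g x) - 1.

(** * The Darboux transform in one chart *)

Section DarbouxInChart.
Variables (R : realType) (n : nat) (r H : R) (A : set 'rV[R]_2).
Variables (f N g : 'rV[R]_2 -> 'rV[R]_n).
Hypotheses (r0 : r != 0) (Aopen : open A).
Hypotheses (sf : smooth_in A f) (sN : smooth_in A N) (sg : smooth_in A g).
Hypothesis NN : forall x, A x -> dot (N x) (N x) = 1.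
Hypothesis fN : forall x, A x -> forall i, dot (partial i f x) (N x) = 0.
Hypothesis g0 : forall x, A x -> g x != 0.

Local Notation dual := (dual_partial H f N).

Hypothesis dg : forall x, A x -> forall i, partial i g x =
  (r * dot (g x) (g x)) *: reflection (g x) (dual i x) - partial i f x.

Let df x : A x -> differentiable f x. Proof. exact: (sf [::]). Qed.
Let dN x : A x -> differentiable N x. Proof. exact: (sN [::]). Qed.
Let dg' x : A x -> differentiable g x. Proof. exact: (sg [::]). Qed.

Let gg_neq0 x : A x -> dot (g x) (g x) != 0.
Proof. by move=> /g0; rewrite -dot_gt0 => /lt0r_neq0. Qed.

Let nearA x : A x -> \near x, A x.
Proof. by move=> Ax; exact: open_nbhs_nbhs. Qed.

(** The part from [df] is orthogonal to [N] by assumption, the part from [dN] because [|N|^2] is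
    constant. *)
Lemma dual_normal x i : A x -> dot (dual i x) (N x) = 0.
Proof.
move=> Ax; rewrite /dual_partial dotDl dotZl fN // mulr0 add0r.
have := is_derive_dot (delta_mx 0 i) (dN Ax) (dN Ax).
move/(@derive_val _ _ _ _ _ _ _).
rewrite (near_eq_derive (g := cst (1 : R^o))) ?derive_cst => [|].
  by rewrite (dotC (N x)) -mulr2n => /esym/eqP; rewrite mulrn_eq0 => /eqP.
by apply: filterS (nearA Ax) => y Ay; rewrite NN.
Qed.

Local Notation darboux_defect := (darboux_defect r H N g).

Let dgg x i : A x ->
  is_derive x (delta_mx 0 i) (fun y => dot (g y) (g y) : R^o)
    (2 * dot (partial i g x) (g x)).
Proof.
move=> Ax; apply: is_derive_eq (is_derive_dot _ (dg' Ax) (dg' Ax)) _.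
by rewrite (dotC (g x)) mulr_natl mulr2n.
Qed.

Lemma darboux_defect_diff x i : A x ->
  is_derive x (delta_mx 0 i) (darboux_defect : _ -> R^o)
    (- (2 * r * dot (g x) (dual i x)) * darboux_defect x).
Proof.
move=> Ax; have dgg' := dgg i Ax.
have dgN := is_derive_dot (delta_mx 0 i) (dg' Ax) (dN Ax).
have D : is_derive x (delta_mx 0 i)
    ((2 * r) \*: (fun x => dot (g x) (N x) : R^o)
     - (r * H) \*: (fun x => dot (g x) (g x) : R^o) - cst (1 : R^o))
    (- (2 * r * dot (g x) (dual i x)) * darboux_defect x); last exact: D.
apply: is_derive_eq; rewrite subr0.
apply: darboux_defect_algebra (g0 Ax) (dg Ax i) _ (fN Ax i) _.
have := dual_normal i Ax; rewrite /dual_partial dotDl dotZl fN // mulr0 add0r.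
exact.
Qed.

Lemma differentiable_darboux_defect x : A x ->
  differentiable (darboux_defect : _ -> R^o) x.
Proof.
move=> Ax; have dgN := differentiable_dot Aopen Ax sg sN.
have dgg' := differentiable_dot Aopen Ax sg sg.
have D : differentiable ((2 * r) \*: (fun x => dot (g x) (N x) : R^o)
     - (r * H) \*: (fun x => dot (g x) (g x) : R^o) - cst (1 : R^o)) x.
  apply: differentiableB; last exact: differentiable_cst.
  by apply: differentiableB; exact: differentiableZ.
exact: D.
Qed.

Lemma smooth_dual_partial i : smooth_in A (dual i).
Proof.
apply/smooth_in_upto => k; apply: smooth_uptoD => //.
  apply: smooth_uptoZ => //; first exact: smooth_upto_cst.
  exact: ((smooth_in_upto A f).1 sf k.+1).2.
exact: ((smooth_in_upto A N).1 sN k.+1).2.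
Qed.

(** These are the coefficients of the linear system satisfied by the defect; [linear_pde_eq0] asks
    for their continuity. *)
Lemma continuous_dot_dual x i : A x ->
  {for x, continuous (fun y => - (2 * r * dot (g y) (dual i y)) : R^o)}.
Proof.
move=> Ax; apply: differentiable_continuous.
have := differentiable_dot Aopen Ax sg (smooth_dual_partial i).
by move=> /(differentiableZ (2 * r))/differentiableN.
Qed.

Lemma darboux_diff x i : A x -> partial i (f \+ g) x =
  (r * dot (g x) (g x)) *: reflection (g x) (dual i x).
Proof.
move=> Ax; have := deriveD (diff_derivable (v := delta_mx 0 i) (df Ax))
  (diff_derivable (v := delta_mx 0 i) (dg' Ax)).
by rewrite -!/(partial i _ _) dg // [partial i f x + _]addrC subrK.
Qed.

Lemma darboux_normal_diff x i : (forall y, A y -> darboux_defect y = 0) ->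
  A x -> partial i (fun y => reflection (g y) (N y)) x =
    (r * dot (g x) (g x))^-1 *: reflection (g x) (partial i f x)
    - H *: partial i (f \+ g) x.
Proof.
move=> defect0 Ax.
pose m y : R^o := r * dot (g y) (g y); pose k y : R^o := (m y)^-1.
have m0 y : A y -> m y != 0 by move=> /gg_neq0; exact: mulf_neq0.
(* Zero defect means [2 (N,g) = (1 + r H |g|^2) / r], so the coefficient [2 (N,g) / |g|^2] in the
   reflection is [H + k]. *)
have reflE y : A y -> reflection (g y) (N y) = N y - H *: g y - k y *: g y.
  move=> Ay; rewrite /reflection -addrA -opprD -scalerDl; congr (_ - _ *: _).
  have -> : 2 * dot (N y) (g y) = (1 + r * H * dot (g y) (g y)) / r.
    apply: (mulfI r0); rewrite [RHS]mulrC mulfVK // dotC.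
    by have := defect0 y Ay; rewrite /darboux_defect; lra.
  by rewrite /k /m; field; rewrite r0 gg_neq0.
have dk : is_derive x (delta_mx 0 i) k
    (- k x ^+ 2 * (r * (2 * dot (partial i g x) (g x)))).
  have dm : is_derive x (delta_mx 0 i) m (r * (2 * dot (partial i g x) (g x))).
    exact: is_deriveZ (dgg i Ax).
  have [dm1 dm2] := dm; apply: DeriveDef.
    exact: (derivableV (f := m) (m0 x Ax) dm1).
  by rewrite (deriveV (f := m) (m0 x Ax) dm1) dm2 /k exprVn.
have dk' : differentiable k x.
  apply: (differentiableV (f := m)); last exact: m0.
  apply: (differentiableZ (f := fun y => dot (g y) (g y) : R^o)).
  exact: (differentiable_dot Aopen Ax sg sg).
have coordP (F : 'rV[R]_2 -> 'rV[R]_n) j : differentiable F x ->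
    is_derive x (delta_mx 0 i) (fun y => F y 0 j : R^o) (partial i F x 0 j).
  move=> dF; rewrite -derive_coord //; apply/derivableP/diff_derivable.
  exact: (differentiable_rVP _ _).1 dF j.
have dref : differentiable (fun y => reflection (g y) (N y)) x.
  apply: (near_eq_differentiable (f := (N - H *: g) - (fun y => k y *: g y))).
    by apply: filterS (nearA Ax) => y Ay; rewrite reflE.
  apply: differentiableB.
    by apply: differentiableB; [exact: dN | apply: differentiableZ; exact: dg'].
  apply/differentiable_rVP => j; rewrite (_ : (fun y => _) =
    k * (fun y => g y 0 j : R^o)); last by apply/funext => y; rewrite mxE.
  by apply: differentiableM => //; exact: (differentiable_rVP _ _).1 (dg' Ax) j.
apply/rowP => j; rewrite -(derive_coord _ _ dref).
have dNj := coordP N j (dN Ax); have dgj := coordP g j (dg' Ax).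
rewrite (near_eq_derive (g := (fun y => N y 0 j : R^o)
  - H \*: (fun y => g y 0 j : R^o) - k * (fun y => g y 0 j : R^o))); last first.
  by apply: filterS (nearA Ax) => y Ay; rewrite reflE // !mxE.
rewrite derive_val darboux_diff //.
rewrite /dual_partial.
have /rowP/(_ j) := darboux_normal_algebra (g0 Ax) r0 (dg Ax i).
rewrite -/(k x) !mxE => <-.
rewrite -[k x *: _]/(k x * _) -[H *: _]/(H * _) -[g x 0 j *: _]/(g x 0 j * _).
by rewrite [g x 0 j * _]mulrC !mulNr.
Qed.

Lemma smooth_reflection : smooth_in A (fun x => reflection (g x) (N x)).
Proof.
apply/smooth_in_upto => k.
have [uN ug] := ((smooth_in_upto A N).1 sN k, (smooth_in_upto A g).1 sg k).
have ugg := smooth_upto_dot Aopen ug ug.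
have u2Ng := smooth_uptoM Aopen (smooth_upto_cst Aopen k (-2 : R^o))
  (smooth_upto_dot Aopen uN ug).
have ucoef := smooth_uptoM Aopen u2Ng (smooth_uptoV Aopen gg_neq0 ugg).
apply: (eq_smooth_upto Aopen _
  (smooth_uptoD Aopen uN (smooth_uptoZ Aopen ucoef ug))) => x Ax /=.
by rewrite /reflection !mulNr scaleNr.
Qed.

Lemma generalised_H_at x (L : 'M[R]_2) : A x ->
    (forall y, A y -> darboux_defect y = 0) ->
    row_free (jac f x) -> row_free (jac (f \+ g) x) ->
    jac N x = L *m jac f x -> dot (mean_curvature_at f x) (N x) = H ->
  dot (mean_curvature_at (f \+ g) x) (reflection (g x) (N x)) = H /\
  forall i, normal_part (f \+ g) x
    (partial i (fun y => reflection (g y) (N y)) x) = 0.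
Proof.
move=> Ax defect0 ffree fgfree NL meanH.
have ddf i : differentiable (partial i f) x by exact: (sf [:: i] Ax).
(* The component of the mean curvature of [f] along [N] is minus half the trace of [L]. *)
have trL : \tr L = - (2 * H).
  rewrite -meanH (mean_curvature_dot Aopen Ax ddf (dN Ax) fN).
  by rewrite first_formE NL trace_shape_operator //; field.
pose q := r * dot (g x) (g x).
have q0 : q != 0 by apply: mulf_neq0; rewrite ?gg_neq0.
(* As [dN = L df], the matrix of [d(f^c)] in the frame [df] is [S]; [P] is the reflection acting on
   row vectors from the right. *)
pose S := H%:M + L; pose P := 1%:M - (2 / dot (g x) (g x)) *: ((g x)^T *m g x).
have reflP u : reflection (g x) u = u *m P.
  rewrite mulmxBr mulmx1 -scalemxAr mulmxA.
  rewrite [u *m _]mx11_scalar -dotE mul_scalar_mx scalerA.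
  by rewrite /reflection mulrAC.
have trS : \tr S = 0 by rewrite linearD /= mxtrace_scalar trL mulr_natl subrr.
have jacfg : jac (f \+ g) x = q *: (S *m (jac f x *m P)).
  apply/row_matrixP => i; rewrite row_jac darboux_diff // reflP /dual_partial.
  rewrite mulmxA linearZ /= -/q row_mul; congr (_ *: (_ *m _)).
  by rewrite mulmxDl mul_scalar_mx -NL linearD linearZ /= !row_jac.
(* With [X] the reflected Jacobian of [f], this produces the matrix [T] of the new normal in the
   frame [d(f+g)], with trace [- 2 H]. *)
have := fgfree; rewrite jacfg => /(shape_darboux H q0 trS)[T].
rewrite -jacfg => TE trT.
pose Nh y := reflection (g y) (N y).
have NhT : jac Nh x = T *m jac (f \+ g) x.
  apply/row_matrixP => i; rewrite -TE row_jac darboux_normal_diff //.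
  have -> (a b : R) (X Y : 'M[R]_(2, n)) :
      row i (a *: X - b *: Y) = a *: row i X - b *: row i Y.
    by apply/rowP => j; rewrite !mxE.
  by rewrite row_mul !row_jac reflP.
split=> [|i]; last first.
  by rewrite -/Nh -row_jac NhT row_mul; exact: normal_part_tangent.
have ddfg i : differentiable (partial i (f \+ g)) x.
  exact: (smooth_inD Aopen sf sg [:: i] Ax).
have dNh : differentiable Nh x by exact: (smooth_reflection [::] Ax).
have fgN y : A y -> forall i, dot (partial i (f \+ g) y) (Nh y) = 0.
  move=> Ay i; rewrite darboux_diff // dotZl dot_reflection ?g0 //.
  by rewrite dual_normal ?mulr0.
apply: etrans (mean_curvature_dot Aopen Ax ddfg dNh fgN) _.
rewrite first_formE NhT.
by rewrite trace_shape_operator // trT; lra.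
Qed.

End DarbouxInChart.

(** * From charts to the surface *)

Lemma smooth_inS (R : realType) n (A B : set 'rV[R]_2)
    (F : 'rV[R]_2 -> 'rV[R]_n) : A `<=` B -> smooth_in B F -> smooth_in A F.
Proof. by move=> AB sF s x /AB; exact: sF. Qed.

Lemma smooth_onS (R : realType) n (M : smooth_surface R) (U V : set M)
    (F : M -> 'rV[R]_n) : U `<=` V -> smooth_on V F -> smooth_on U F.
Proof.
move=> UV sF c ac; apply: smooth_inS (sF c ac).
by apply: image_subset; exact: setSI.
Qed.

(** Within the open image of the chart, the image of [U] is the preimage of [U] under [chart_inv c],
    which is continuous there. *)
Lemma chart_image_open (R : realType) (T : topologicalType) (c : chart R T)
  (U : set T) : is_chart c -> open U ->
  open (chart_map c @` (U `&` chart_dom c)).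
Proof.
case=> dom_open im_open mapK _ inv_cont Uopen; rewrite openE.
move=> _ [p [Up cp] <-].
have im_p : (chart_map c @` chart_dom c) (chart_map c p) by exists p.
have : nbhs (chart_map c p) (chart_inv c @^-1` U).
  by apply: inv_cont => //; rewrite mapK //; exact: open_nbhs_nbhs.
have := open_nbhs_nbhs (conj im_open im_p).
by apply: filterS2 => _ [q cq <-] /=; rewrite mapK // => Uq; exists q.
Qed.

Section DarbouxTransform.
Variables (R : realType) (n : nat) (M : smooth_surface R) (r H : R) (V : set M).
Variables (f N g : M -> 'rV[R]_n).
Hypotheses (r0 : r != 0) (Vopen : open V).
Hypotheses (sf : smooth_on V f) (sN : smooth_on V N) (sg : smooth_on V g).
Hypothesis NN : forall p, V p -> dot (N p) (N p) = 1.
Hypothesis fN : forall p c, V p -> charts_at p c ->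
  forall i, dot (diff_chart c i f p) (N p) = 0.
Hypothesis g0 : forall p, V p -> g p != 0.
Hypothesis dg : forall p c, V p -> charts_at p c -> forall i,
  diff_chart c i g p = (r * dot (g p) (g p)) *:
    reflection (g p) (H *: diff_chart c i f p + diff_chart c i N p)
  - diff_chart c i f p.

Section Chart.
Variable c : chart R M.
Hypothesis ac : atlas c.

Let A := chart_map c @` (V `&` chart_dom c).
Let fc := f \o chart_inv c.
Let Nc := N \o chart_inv c.
Let gc := g \o chart_inv c.

Lemma chart_setP x : A x -> [/\ V (chart_inv c x), charts_at (chart_inv c x) c
  & chart_map c (chart_inv c x) = x].
Proof.
have [_ _ mapK _ _] := atlas_chart ac.
by case=> p [Vp cp] <-; rewrite mapK.
Qed.

Lemma chart_set_open : open A.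
Proof. exact: chart_image_open (atlas_chart ac) Vopen. Qed.

Lemma chart_NN x : A x -> dot (Nc x) (Nc x) = 1.
Proof. by move=> /chart_setP[Vp _ _]; exact: NN. Qed.

Lemma chart_fN x : A x -> forall i, dot (partial i fc x) (Nc x) = 0.
Proof.
move=> /chart_setP[Vp cp cpE] i.
by rewrite -{1}cpE; exact: fN.
Qed.

Lemma chart_g0 x : A x -> gc x != 0.
Proof. by move=> /chart_setP[Vp _ _]; exact: g0. Qed.

Lemma chart_dg x : A x -> forall i, partial i gc x =
  (r * dot (gc x) (gc x)) *:
    reflection (gc x) (H *: partial i fc x + partial i Nc x) - partial i fc x.
Proof.
move=> /chart_setP[Vp cp cpE] i.
by have := dg Vp cp i; rewrite /diff_chart cpE.
Qed.

Lemma chart_smooth : [/\ smooth_in A fc, smooth_in A Nc & smooth_in A gc].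
Proof. by split; [exact: sf | exact: sN | exact: sg]. Qed.

End Chart.

(** Zeros of the defect spread over small coordinate balls by its linear system, then over [V] by
    connectedness. *)
Lemma darboux_defect_eq0 (o : M) : connected V -> V o ->
  darboux_defect r H N g o = 0 ->
  forall p, V p -> darboux_defect r H N g p = 0.
Proof.
move=> Vconn Vo defecto.
apply: (connected_locally_constant Vopen Vconn Vo defecto) => p Vp.
have [c ac cp] := atlas_cover p.
have [cdom _ mapK map_cont _] := atlas_chart ac.
have [uf uN ug] := chart_smooth ac.
set A := chart_map c @` (V `&` chart_dom c) in uf uN ug *.
set fc := f \o chart_inv c in uf; set Nc := N \o chart_inv c in uN.
set gc := g \o chart_inv c in ug.
have Aopen : open A by exact: chart_set_open.
pose b i y : R^o := - (2 * r * dot (gc y) (dual_partial H fc Nc i y)).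
have Ap : A (chart_map c p) by exists p.
have ddefect y (Ay : A y) i := darboux_defect_diff Aopen uN ug
  (chart_NN ac) (chart_fN ac) (chart_g0 ac) (chart_dg ac) i Ay.
have psidiff y (Ay : A y) := differentiable_darboux_defect r H Aopen uN ug Ay.
have cb i : {for chart_map c p, continuous (b i)}.
  exact: (@continuous_dot_dual _ _ r H _ _ _ _ Aopen uf uN ug _ i Ap).
have psipartial y i (Ay : A y) :
    partial i (darboux_defect r H Nc gc : _ -> R^o) y
    = b i y * darboux_defect r H Nc gc y.
  by have [_] := ddefect y Ay i; exact.
have [e e0 [eA eP]] := linear_pde_eq0 Aopen Ap psidiff psipartial cb.
(* The part of the chart domain lying over the ball is open by continuity of [chart_map c]. *)
exists (chart_dom c `&` chart_map c @^-1` ball (chart_map c p) e).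
  split; last by split=> //=; exact: ballxx.
  rewrite openE => q [cq bq]; apply: filterI; first exact: open_nbhs_nbhs.
  by apply: map_cont => //; apply: open_nbhs_nbhs; split=> //; exact: ball_open.
move=> q s [cq bq] [cs bs]; have := eP _ _ bq bs.
by rewrite /darboux_defect /gc /Nc /= !mapK.
Qed.

End DarbouxTransform.

Theorem theorem2p17 (R : realType) (n : nat) (M : smooth_surface R)
  (f N : M -> 'rV[R]_n) (H : R)
  (f_immersion : immersion_on setT f)
  (N_isoperimetric : isoperimetric_section setT f N H)
  (N_parallel : normal_parallel setT f N)
  (fc : M -> 'rV[R]_n) (fcE : forall p, fc p = H *: f p + N p)
  (fc_nonconstant : ~ exists w, forall p, fc p = w)
  (o : M) (v : 'rV[R]_n) (r : R) (r_neq0 : r != 0)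
  (v_init : (r * H) *: cl_vec (v - f o) ^+ 2
            - r *: anticomm (cl_vec (v - f o)) (cl_vec (N o)) = 1)
  (V : set M) (V_open : open V) (V_connected : connected V) (Vo : V o)
  (g : M -> 'rV[R]_n) (g_sol : darboux_solution V o v r f fc g) :
  generalised_H_surface (V `&` [set p | immersed_at (f \+ g) p]) (f \+ g) H.
Proof.
have [f_smooth f_immersed] := f_immersion.
have [[N_smooth N_unit_normal] meanH] := N_isoperimetric.
have [sg g0 dgC go] := g_sol.
have sf : smooth_on V f by exact: smooth_onS f_smooth.
have sN : smooth_on V N by exact: smooth_onS N_smooth.
have NN p : V p -> dot (N p) (N p) = 1.
  by move=> _; exact: (N_unit_normal p I).1.
have fN p c : V p -> charts_at p c ->
    forall i, dot (diff_chart c i f p) (N p) = 0.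
  by move=> _; exact: (N_unit_normal p I).2.
(* The sandwich identity puts both sides of the Clifford equation in the image of [cl_vec], and
   injectivity returns an equation of vectors. *)
have dg p c : V p -> charts_at p c -> forall i,
    diff_chart c i g p = (r * dot (g p) (g p)) *:
      reflection (g p) (H *: diff_chart c i f p + diff_chart c i N p)
    - diff_chart c i f p.
  move=> Vp cp i; apply: cl_vec_inj; rewrite dgC // cl_vecB -scalerA cl_vecZ.
  rewrite cl_vec_sandwich; congr (_ *: cl_vec (_ *: reflection _ _) - _).
  have [ac cdp] := cp.
  have Ap : (chart_map c @` (V `&` chart_dom c)) (chart_map c p) by exists p.
  have df := sf c ac [::] _ Ap; have dN := sN c ac [::] _ Ap.
  rewrite /diff_chart.
  rewrite (_ : fc \o _ = H *: (f \o chart_inv c) + (N \o chart_inv c)).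
    rewrite /partial deriveD ?deriveZ //; first exact: diff_derivable.
      by apply: derivableZ; exact: diff_derivable.
    exact: diff_derivable.
  by apply/funext => x /=; rewrite fcE.
(* At [o] both sides of [v_init] are multiples of the unit, and comparing the scalars gives zero
   defect there. *)
have defect0 p : V p -> darboux_defect r H N g p = 0.
  apply: (darboux_defect_eq0 V_open sf sN sg NN fN g0 dg V_connected Vo).
  move: v_init; rewrite -go expr2 cl_vec_sqr /anticomm cl_vec_clifford.
  rewrite !scalerA -scalerBl -[RHS]scale1r => /cl_scalar_inj.
  by rewrite /darboux_defect; lra.
have W_V : V `&` [set p | immersed_at (f \+ g) p] `<=` V by exact: subIsetl.
split; first split=> [|p []//].
  apply: (smooth_onS W_V) => c ac.
  exact: (smooth_inD (chart_set_open V_open ac) (sf c ac) (sg c ac)).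
exists (fun p => reflection (g p) (N p)).
have H_at p c : V p -> immersed_at (f \+ g) p -> charts_at p c ->
  dot (mean_curvature c (f \+ g) p) (reflection (g p) (N p)) = H /\
  forall i, normal_part ((f \+ g) \o chart_inv c) (chart_map c p)
    (diff_chart c i (fun p => reflection (g p) (N p)) p) = 0.
  move=> Vp fgp cp; have [ac cdp] := cp.
  have Ap : (chart_map c @` (V `&` chart_dom c)) (chart_map c p) by exists p.
  have [_ _ mapK _ _] := atlas_chart ac.
  (* Parallelism of [N] supplies its Weingarten matrix [L]. *)
  have [L NL] := normal_part_eq0 (N_parallel p I c cp).
  have Adefect y : (chart_map c @` (V `&` chart_dom c)) y ->
      darboux_defect r H (N \o chart_inv c) (g \o chart_inv c) y = 0.
    by move=> /(chart_setP ac)[Vy _ _]; exact: (defect0 (chart_inv c y)).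
  have meanHc : dot (mean_curvature_at (f \o chart_inv c) (chart_map c p))
      ((N \o chart_inv c) (chart_map c p)) = H.
    by rewrite /= mapK //; exact: meanH.
  have := generalised_H_at r_neq0 (chart_set_open V_open ac) (sf c ac) (sN c ac)
    (sg c ac) (chart_NN NN ac) (chart_fN fN ac) (chart_g0 g0 ac)
    (chart_dg dg ac) Ap Adefect (f_immersed p I c cp) (fgp c cp) NL meanHc.
  by rewrite /= mapK.
(* The reflection preserves inner products, so the pairing reduces to that of [d(f^c)] with [N]. *)
have normal p c : V p -> charts_at p c -> forall i,
  dot (diff_chart c i (f \+ g) p) (reflection (g p) (N p)) = 0.
  move=> Vp cp i; have [ac cdp] := cp.
  have Ap : (chart_map c @` (V `&` chart_dom c)) (chart_map c p) by exists p.
  have [_ _ mapK _ _] := atlas_chart ac.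
  rewrite /diff_chart.
  rewrite -[(f \+ g) \o _]/((f \o chart_inv c) \+ (g \o chart_inv c)).
  rewrite (darboux_diff (sf c ac) (sg c ac) (chart_dg dg ac)) // dotZl /=.
  rewrite mapK // dot_reflection ?g0 //.
  have := dual_normal H (chart_set_open V_open ac) (sN c ac) (chart_NN NN ac)
    (chart_fN fN ac) i Ap.
  by rewrite /= mapK // => ->; rewrite mulr0.
split; first split; first split.
- apply: (smooth_onS W_V) => c ac.
  apply: smooth_reflection (chart_set_open V_open ac) (sN c ac) (sg c ac) _.
  exact: chart_g0.
- move=> p [Vp _]; split=> [|c cp]; last exact: normal.
  by rewrite dot_reflection ?g0 ?NN.
- by move=> p [Vp fgp] c cp; have [] := H_at p c.
- by move=> p [Vp fgp] c cp; have [] := H_at p c.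
Qed.
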